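(* Let $G$ be a finite connected $P_5$-free graph with $\alpha(G)\ge 3$. Then there is a three-vertex induced path of $G$ with vertices $a,b,c$ in this order (so $ab,bc\in E(G)$ and $ac\notin E(G)$) such that every neighbour of $c$ is also adjacent to at least one of $a,b$.
   Context: Graphs are finite and simple. $P_5$ is the path on five vertices; $G$ is $P_5$-free if no induced subgraph of $G$ is isomorphic to $P_5$. $\alpha(G)$ denotes the independence number of $G$, the maximum size of a stable (independent) set of vertices. *)

(* Defs.v *)
From mathcomp Require Import all_boot.

Set Implicit Arguments.
Unset Strict Implicit.
Unset Printing Implicit Defensive.

(* A finite simple graph on the vertex set T is a symmetric irreflexive
   e : rel T; these two properties are hypotheses of the theorem. *)

Definition connected_graph (T : finType) (e : rel T) : Prop :=
  forall x y : T, connect e x y.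

Definition stable (T : finType) (e : rel T) (S : {set T}) : bool :=
  [forall x in S, forall y in S, ~~ e x y].

Definition independence_number (T : finType) (e : rel T) : nat :=
  \max_(S : {set T} | stable e S) #|S|.

Definition induced_subgraph (T : finType) (e : rel T) (S : {set T}) :
    rel {x : T | x \in S} :=
  fun x y => e (val x) (val y).

Definition graph_isomorphic (U V : finType) (e : rel U) (e' : rel V) : Prop :=
  exists f : U -> V, bijective f /\ forall x y : U, e' (f x) (f y) = e x y.

Definition path_graph (n : nat) : rel 'I_n :=
  fun i j => (i.+1 == j :> nat) || (j.+1 == i :> nat).

Definition P5_free (T : finType) (e : rel T) : Prop :=
  forall S : {set T},
    ~ graph_isomorphic (@induced_subgraph T e S) (@path_graph 5).

Definition induced_path3 (T : finType) (e : rel T) (a b c : T) : bool :=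
  [&& uniq [:: a; b; c], e a b, e b c & ~~ e a c].

(* Main.v *)
Require Import Defs.
From Stdlib Require Import NArith.
From mathcomp Require Import all_boot all_order all_algebra all_field.
From mathcomp Require Import zify ring.

Set Implicit Arguments.
Unset Strict Implicit.
Unset Printing Implicit Defensive.

Import Order.TTheory GRing.Theory Num.Theory.

(* A counterexample is a graph in which every induced path a-b-c can be
   prolonged to an induced a-b-c-d, hence (P5-freeness) closed into an induced
   5-cycle.  Let G be a minimal one.  The non-neighbours of any vertex u induce
   a connected graph, and induced paths inside it can only be prolonged inside
   it; by minimality it has no stable triple, so G has no stable set of size 4.
   Minimality also forbids adjacent twins, and then any two adjacent vertices
   have exactly two common non-neighbours, which are not adjacent.

   In the complement H of G this reads: H has no K4, and two distinct
   non-adjacent vertices have exactly two common neighbours, which are adjacent.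
   The neighbourhood of a vertex in H is then a Moore graph of diameter 2, and H
   is strongly regular of degree k^2 + 1 with parameters lambda = k and mu = 2.
   The multiplicities of the eigenvalues of H would satisfy an equation that
   has no integral solution with k >= 2. *)

(** * Minimal counterexamples *)

(** Adjacency in the complement; the inequality makes it irreflexive. *)
Definition anti (T : eqType) (e : rel T) : rel T :=
  fun x y => (x != y) && ~~ e x y.

Lemma anti_nadj (T : eqType) (e : rel T) x y : anti e x y -> ~~ e x y.
Proof. by case/andP. Qed.

Lemma anti_neq (T : eqType) (e : rel T) x y : anti e x y -> x != y.
Proof. by case/andP. Qed.

Lemma anti_sym (T : eqType) (e : rel T) : symmetric e -> symmetric (anti e).
Proof. by move=> se x y; rewrite /anti eq_sym se. Qed.

Lemma antixx (T : eqType) (e : rel T) x : anti e x x = false.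
Proof. by rewrite /anti eqxx. Qed.

Lemma adj_neq (T : eqType) (e : rel T) x y z : e x z -> ~~ e y z -> x != y.
Proof. by move=> xz; apply: contraNneq => <-. Qed.

(** In a simple graph this pattern of adjacencies already forces the five vertices to be
    distinct. *)
Definition no_induced_path5 (T : Type) (e : rel T) : Prop :=
  forall a b c d f, e a b -> e b c -> e c d -> e d f ->
  ~~ e a c -> ~~ e a d -> ~~ e a f -> ~~ e b d -> ~~ e b f -> ~~ e c f ->
  False.

(** Connectivity of the subgraph induced on [S], phrased by cuts: any property separating two
    vertices of [S] yields an edge across it. *)
Definition cut_connected (T : finType) (e : rel T) (S : {set T}) : Prop :=
  forall (P : pred T) x y, x \in S -> y \in S -> P x -> ~~ P y ->
  exists a b, [/\ a \in S, b \in S, P a, ~~ P b & e a b].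

Definition stable_triple (T : finType) (e : rel T) (S : {set T}) : Prop :=
  exists x y z, [/\ x \in S, y \in S & z \in S] /\
    [/\ anti e x y, anti e x z & anti e y z].

Definition dominating_end (T : finType) (e : rel T) (S : {set T}) : Prop :=
  exists a b c, [/\ a \in S, b \in S & c \in S] /\
    [/\ e a b, e b c, anti e a c &
        forall v, v \in S -> e c v -> e v a || e v b].

Section MinimalCounterexample.

Variables (T : finType) (e : rel T).
Hypotheses (e_sym : symmetric e) (e_irr : irreflexive e).
Hypothesis P5 : no_induced_path5 e.
Hypothesis conn : cut_connected e setT.
Hypothesis triple : stable_triple e setT.
Hypothesis bad : ~ dominating_end e setT.
(** Minimality: the vertex [x] witnesses that [S] is proper. *)
Hypothesis IH : forall (S : {set T}) x, x \notin S ->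
  cut_connected e S -> stable_triple e S -> dominating_end e S.

Local Notation anti := (anti e).

Let asym : symmetric anti := anti_sym e_sym.

Ltac adj := first [ assumption | rewrite e_sym; assumption
  | apply: anti_nadj; assumption
  | apply: anti_nadj; rewrite asym; assumption
  | rewrite asym; assumption ].
Ltac path5 a b c d f := exfalso; apply: (@P5 a b c d f); adj.

Lemma extend a b c : e a b -> e b c -> anti a c ->
  exists d, [/\ e c d, anti d a & anti d b].
Proof.
move=> ab bc ac; have [a_c nac] := andP ac.
case: (boolP [exists d, [&& e c d, ~~ e d a & ~~ e d b]]) => [/existsP[d]|].
  case/and3P=> cd da db; exists d; split=> //; apply/andP; split=> //.
    by apply: contraNneq nac => <-; rewrite e_sym.
  by apply: contraNneq da => ->; rewrite e_sym.
move/existsPn=> no; case: bad; exists a, b, c; split; first by rewrite !inE.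
split=> // v _ cv; have := no v; rewrite cv /= -negb_or negbK.
by [].
Qed.

(** Prolong [a]-[b]-[c] to [d], then [b]-[c]-[d] to [f]; without the edge [f a] the five vertices
    would induce a path. *)
Lemma extend_cycle5 a b c : e a b -> e b c -> anti a c ->
  exists d f, [/\ e c d, anti d a & anti d b] /\
    [/\ e d f, e f a, anti f b & anti f c].
Proof.
move=> ab bc ac; have [d [cd da db]] := extend ab bc ac.
have bd : anti b d by rewrite asym.
have [f [df fb fc]] := extend bc cd bd.
exists d, f; split=> //; split=> //.
case: (boolP (e f a)) => // fa; path5 a b c d f.
Qed.

(** * Non-neighbours of a vertex *)

Definition nonnbr u : {set T} := [set x | anti u x].

Lemma nonnbr_connected u : cut_connected e (nonnbr u).
Proof.
move=> P x y xM yM Px nPy.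
case: (boolP [exists a, [exists b,
  [&& a \in nonnbr u, b \in nonnbr u, P a, ~~ P b & e a b]]]) => [|no].
  by case/existsP=> a /existsP[b] /and5P[? ? ? ? ?]; exists a, b.
have nocross a b : a \in nonnbr u -> b \in nonnbr u -> P a -> ~~ P b -> ~~ e a b.
  move=> aM bM Pa nPb; apply/negP=> ab; case/negP: no.
  by apply/existsP; exists a; apply/existsP; exists b; rewrite aM bM Pa nPb.
(* Closing [a]-[n]-[u] into an induced 5-cycle gives a non-neighbour [f] of [u] adjacent to [a]; it
   stays on the side of [a]. *)
have nb (P' : pred T)
    (nc : forall a b, a \in nonnbr u -> b \in nonnbr u -> P' a -> ~~ P' b -> ~~ e a b)
    n a : e u n -> a \in nonnbr u -> P' a -> e n a ->
    exists f, [/\ f \in nonnbr u, P' f, e f a & ~~ e f n].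
  rewrite inE => un ua P'a na.
  have an : e a n by adj.
  have nu : e n u by adj.
  have au : anti a u by adj.
  have [d [f [[ud da dn] [df fa fn fu]]]] := extend_cycle5 an nu au.
  have fM : f \in nonnbr u by rewrite inE asym.
  exists f; split=> //; last by adj.
  case: (boolP (P' f)) => // nP'f.
  by have := nc a f; rewrite inE e_sym fa => /(_ ua fM P'a nP'f).
(* An edge leaving one side of the cut can only end at a neighbour of [u]. *)
have touch (P' : pred T)
    (nc : forall a b, a \in nonnbr u -> b \in nonnbr u -> P' a -> ~~ P' b -> ~~ e a b)
    z : z \in nonnbr u -> P' z ->
    exists n a, [/\ e u n, a \in nonnbr u, P' a & e n a].
  move=> zM P'z.
  have Pz : [pred t | (t \in nonnbr u) && P' t] z by rewrite /= zM.
  have nPu : ~~ [pred t | (t \in nonnbr u) && P' t] u by rewrite /= inE antixx.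
  have [a [b [_ _ /andP[aM P'a] nPb ab]]] := conn (in_setT z) (in_setT u) Pz nPu.
  exists b, a; split=> //; last by adj.
  move: nPb; rewrite /= negb_and; case/orP=> [|nP'b]; last first.
    case: (boolP (b \in nonnbr u)) => [bM|]; first by have := nc a b aM bM P'a nP'b; rewrite ab.
    rewrite inE negb_and !negbK => /orP[/eqP ub|//].
    by move: aM ab; rewrite inE -ub => /anti_nadj; rewrite e_sym => /negPf ->.
  rewrite inE negb_and !negbK => /orP[/eqP ub|//].
  by move: aM ab; rewrite inE -ub => /anti_nadj; rewrite e_sym => /negPf ->.
have nocross' a b : a \in nonnbr u -> b \in nonnbr u -> predC P a -> ~~ predC P b ->
  ~~ e a b.
  by move=> aM bM /= nPa; rewrite negbK e_sym => Pb; apply: nocross.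
have [n [a [un aM Pa na]]] := touch P nocross x xM Px.
have [m [b [um bM nPb mb]]] := touch (predC P) nocross' y yM nPy.
have [f [fM Pf fa fn]] := nb P nocross n a un aM Pa na.
have [g [gM nPg gb gm]] := nb (predC P) nocross' m b um bM nPb mb.
(* A neighbour of [u] attached to both sides would be the middle of an induced five-vertex path,
   with two vertices on each side. *)
have both k s t : e u k -> s \in nonnbr u -> P s -> e k s ->
    t \in nonnbr u -> ~~ P t -> e k t -> False.
  move=> uk sM Ps ks tM nPt kt.
  have [s' [s'M Ps' s's s'k]] := nb P nocross k s uk sM Ps ks.
  have [t' [t'M nPt' t't t'k]] := nb (predC P) nocross' k t uk tM nPt kt.
  apply: (@P5 s' s k t t'); try adj; try by apply: nocross.
have nb_ : ~~ e n b by apply/negP=> nb'; apply: (both n a b).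
have ma_ : ~~ e m a by apply/negP=> ma; apply: (both m a b).
have mf_ : ~~ e m f by apply/negP=> mf; apply: (both m f b).
have ab_ := nocross a b aM bM Pa nPb.
have fb_ := nocross f b fM bM Pf nPb.
move: aM bM fM; rewrite !inE => ua ub uf.
(* The attachments [n] and [m] of the two sides differ; joined directly or through [u], they give an
   induced five-vertex path. *)
have [nm|nm] := boolP (e n m).
  path5 f a n m b.
path5 a n u m b.
Qed.

(** Minimality gives a dominating path [a]-[b]-[c] among the non-neighbours of [u]. Its prolongation
    [d] in the whole graph must be adjacent to [u], and [u]-[d]-[c]-[b]-[a] is induced. *)
Lemma no_stable4 u x y z : anti u x -> anti u y -> anti u z ->
  anti x y -> anti x z -> anti y z -> False.
Proof.
move=> ux uy uz xy xz yz.
have [||a [b [c [[aM bM cM] [ab bc ac dom]]]]] := @IH (nonnbr u) u _ (@nonnbr_connected u).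
- by rewrite inE antixx.
- by exists x, y, z; rewrite !inE.
have [d [cd da db]] := extend ab bc ac.
have := dom d; rewrite cd (negPf (anti_nadj da)) (negPf (anti_nadj db)) /=.
move: aM bM cM; rewrite !inE => ua ub uc.
have [|ud _] := boolP (anti u d); first by move=> _ /(_ isT isT).
have {ud} : e u d.
  move: ud; rewrite negb_and negbK negbK => /orP[/eqP ud|//].
  by move: cd uc; rewrite -ud e_sym => cd /anti_nadj; rewrite cd.
move=> ud; path5 u d c b a.
Qed.

(** * Common non-neighbours of two adjacent vertices *)

Definition cocommon u v q := anti u q && anti v q.

Lemma cocommonC u v q : cocommon u v q = cocommon v u q.
Proof. exact: andbC. Qed.

Lemma adj_of_not_cocommon u v w : anti u w -> ~~ cocommon u v w -> e u v -> e v w.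
Proof.
move=> uw; rewrite /cocommon uw /= negb_and !negbK => /orP[/eqP vw|//] uv.
by move: (anti_nadj uw); rewrite -vw uv.
Qed.

Lemma adj_of_not_anti u w d : anti u w -> e w d -> ~~ anti u d -> e u d.
Proof.
move=> uw wd; rewrite negb_and !negbK => /orP[/eqP ud|//].
by move: (anti_nadj uw); rewrite ud e_sym wd.
Qed.

Definition nonnbr_nonclique u :=
  [exists p, [exists q, [&& anti u p, anti u q & anti p q]]].

Lemma cocommon_nonclique u v : e u v -> nonnbr_nonclique u ->
  exists p q, [/\ cocommon u v p, cocommon u v q & anti p q].
Proof.
move=> uv /existsP[p /existsP[p' /and3P[up up' pp']]].
case: (boolP [exists p, [exists q,
  [&& cocommon u v p, cocommon u v q & anti p q]]]) => [|no].
  by case/existsP=> x /existsP[y /and3P[? ? ?]]; exists x, y.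
(* From here on the common non-neighbours are supposed to form a clique. *)
have cl x y : cocommon u v x -> cocommon u v y -> ~~ anti x y.
  move=> Qx Qy; apply/negP=> xy; case/negP: no.
  by apply/existsP; exists x; apply/existsP; exists y; rewrite Qx Qy.
have hit r : anti u r -> e v r -> exists2 q, cocommon u v q & e r q.
  move=> ur vr; have [d [rd du dv]] := extend uv vr ur.
  by exists d; rewrite // /cocommon asym du asym dv.
(* [r] has some neighbour in the clique; missing another vertex of it would give the induced path
   [u]-[v]-[r]-[x]-[q]. *)
have join r q : anti u r -> e v r -> cocommon u v q -> e r q.
  move=> ur vr Qq; have [x Qx rx] := hit r ur vr.
  have := cl x q Qx Qq; rewrite negb_and !negbK => /orP[/eqP<-//|xq].
  apply: contraT => rq; case/andP: Qx => ux vx; case/andP: Qq => uq vq.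
  path5 u v r x q.
case: (boolP (cocommon u v p)) => Qp; case: (boolP (cocommon u v p')) => Qp'.
- by have := cl p p' Qp Qp'; rewrite pp'.
- have vp' := adj_of_not_cocommon up' Qp' uv.
  by have := join p' p up' vp' Qp; rewrite e_sym (negPf (anti_nadj pp')).
- have vp := adj_of_not_cocommon up Qp uv.
  by have := join p p' up vp Qp'; rewrite (negPf (anti_nadj pp')).
have vp := adj_of_not_cocommon up Qp uv; have vp' := adj_of_not_cocommon up' Qp' uv.
have [q Qq pq] := hit p up vp; have p'q := join p' q up' vp' Qq.
have qp' : e q p' by adj.
have [d [p'd dp dq]] := extend pq qp' pp'.
have [uq vq] := andP Qq.
have [ud|nud] := boolP (anti u d); last first.
  have ud := adj_of_not_anti up' p'd nud; path5 u d p' q p.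
have [Qd|Qd] := boolP (cocommon u v d).
  by have := join p d up vp Qd; rewrite e_sym (negPf (anti_nadj dp)).
have := join d q ud (adj_of_not_cocommon ud Qd uv) Qq.
by rewrite (negPf (anti_nadj dq)).
Qed.

(** The property passes along edges, since the pair found for one end consists of common
    non-neighbours of both; connectivity does the rest. *)
Lemma all_nonnbr_nonclique u : nonnbr_nonclique u.
Proof.
have [x [y [z [_ [xy xz yz]]]]] := triple.
have Px : nonnbr_nonclique x.
  by apply/existsP; exists y; apply/existsP; exists z; rewrite xy xz.
apply: contraT => nPu.
have [a [b [_ _ Pa nPb ab]]] := conn (in_setT x) (in_setT u) Px nPu.
have [p [q [/andP[_ bp] /andP[_ bq] pq]]] := cocommon_nonclique ab Pa.
case/negP: nPb; apply/existsP; exists p; apply/existsP; exists q.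
by rewrite bp bq.
Qed.

Lemma cocommon_pair u v : e u v ->
  exists p q, [/\ cocommon u v p, cocommon u v q & anti p q].
Proof. by move=> uv; apply: cocommon_nonclique (all_nonnbr_nonclique u). Qed.

Lemma no_adjacent_twins u v : e u v -> exists w, [/\ w != u, w != v & e u w != e v w].
Proof.
move=> uv.
case: (boolP [exists w, [&& w != u, w != v & e u w != e v w]]) => [|no].
  by case/existsP=> w /and3P[? ? ?]; exists w.
have tw w : w != u -> w != v -> e u w = e v w.
  move=> wu wv; apply/eqP; apply: contraT => ne; case/negP: no.
  by apply/existsP; exists w; rewrite wu wv.
have u_v : u != v by apply: contraTneq uv => ->; rewrite e_irr.
have inS w : (w \in [set~ v]) = (w != v) by rewrite !inE.
have [|||a [b [c [[aS bS cS] [ab bc ac dom]]]]] := @IH [set~ v] v.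
- by rewrite inS eqxx.
- move=> P x y; rewrite !inS => xv yv Px nPy.
  (* Deleting [v] keeps the graph connected: its twin [u] replaces it on any crossing edge. *)
  pose P' z := if z == v then P u else P z.
  have P'x : P' x by rewrite /P' (negPf xv).
  have nP'y : ~~ P' y by rewrite /P' (negPf yv).
  have [a [b [_ _ P'a nP'b ab]]] := conn (in_setT x) (in_setT y) P'x nP'y.
  move: P'a nP'b; rewrite /P'; have [av|av] := eqVneq a v.
    have [bv|bv] := eqVneq b v; first by move=> ->.
    move=> Pu nPb; exists u, b; rewrite !inS; split=> //.
    rewrite tw // -?av //; by apply: contraNneq nPb => ->.
  have [bv|bv] := eqVneq b v => Pa nPb; last by exists a, b; rewrite !inS.
  exists a, u; rewrite !inS; split=> //.
  by rewrite e_sym tw // -?bv 1?e_sym //; apply: contraTneq Pa => ->.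
- have [p [q [/andP[up vp] /andP[uq vq] pq]]] := cocommon_pair uv.
  exists u, p, q; rewrite !inS u_v; split=> //.
  by split=> //; rewrite eq_sym ?(anti_neq vp) ?(anti_neq vq).
(* The prolongation [d] can only be the deleted [v]. Then [u] is adjacent to [c], hence to [a] or
   [b], and so is its twin [v]: a contradiction. *)
have [d [cd da db]] := extend ab bc ac.
have := dom d; rewrite cd (negPf (anti_nadj da)) (negPf (anti_nadj db)) inS /=.
have [dv|] := eqVneq d v; last by move=> _ /(_ isT isT).
move=> _; rewrite !inS in aS bS cS.
have trans w : w != v -> ~~ e v w -> ~~ e u w.
  move=> wv; have [->|wu] := eqVneq w u; first by rewrite e_irr.
  by rewrite tw.
have cu : c != u.
  apply: contraNneq (anti_nadj db) => cu.
  by rewrite dv -tw // -?cu 1?e_sym //; apply: adj_neq bc _; rewrite e_irr.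
have := dom u; rewrite inS u_v e_sym tw // -dv e_sym cd => /(_ isT isT).
have ua := trans a aS; have ub := trans b bS.
move: da db; rewrite dv => /anti_nadj/ua/negPf -> /anti_nadj/ub/negPf ->.
by [].
Qed.

(** Otherwise [u]-[v]-[r]-[p]-[q] is an induced path. Hence adjacency to [r] is constant on each
    component of the common non-neighbours. *)
Lemma cocommon_closed u v r p q : e u v -> e v r -> anti u r ->
  cocommon u v p -> cocommon u v q -> e p q -> e r p -> e r q.
Proof.
move=> uv vr ur /andP[up vp] /andP[uq vq] pq rp.
apply: contraT => rq; path5 u v r p q.
Qed.

Lemma cocommon_noP3_aux u v y p q r : e u v -> anti u y -> e v y ->
  cocommon u v p -> cocommon u v q -> cocommon u v r ->
  e p q -> e q r -> anti p r -> False.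
Proof.
move=> uv uy vy Qp Qq Qr pq qr pr.
pose R : rel T := [rel a b | [&& e a b, cocommon u v a & cocommon u v b]].
have clQ : closed R (cocommon u v) by move=> a b /and3P[_ Qa Qb]; apply: etrans (esym Qb).
have RQ a : connect R p a -> cocommon u v a.
  by move=> pa; rewrite -[cocommon _ _ _](closed_connect clQ pa).
have nRy : ~~ connect R p y.
  apply/negP=> /RQ /andP[_ /anti_nadj]; by rewrite vy.
have [up vp] := andP Qp.
have pM : p \in nonnbr u by rewrite inE.
have yM : y \in nonnbr u by rewrite inE.
(* This edge leaves the component of [p], so [b] is adjacent to [v] and therefore to the whole
   component; then [p]-[b]-[r] is prolonged. *)
have [a [b [aM bM pa npb ab]]] := nonnbr_connected pM yM (connect0 R p) nRy.
rewrite !inE in aM bM; have Qa := RQ a pa.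
have nQb : ~~ cocommon u v b.
  apply: contra npb => Qb; apply: connect_trans pa (connect1 _).
  by rewrite /R /= ab Qa.
have vb := adj_of_not_cocommon bM nQb uv.
have clb : closed R (e b).
  move=> c d /and3P[cd Qc Qd]; apply/idP/idP.
    exact: cocommon_closed uv vb bM Qc Qd cd.
  by apply: cocommon_closed uv vb bM Qd Qc _; adj.
have bp : e b p.
  by rewrite [e b p](closed_connect clb pa); change (e b a); adj.
have bq := cocommon_closed uv vb bM Qp Qq pq bp.
have br := cocommon_closed uv vb bM Qq Qr qr bq.
have pb : e p b by adj.
have [d [rd dp db]] := extend pb br pr.
have [ur vr] := andP Qr.
have [ud|nud] := boolP (anti u d); last first.
  have ud := adj_of_not_anti ur rd nud; path5 u d r b p.
have [Qd|Qd] := boolP (cocommon u v d).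
  have := cocommon_closed uv vb bM Qr Qd rd br.
  by rewrite e_sym (negPf (anti_nadj db)).
have vd := adj_of_not_cocommon ud Qd uv.
have dr : e d r by adj.
have rq : e r q by adj.
have qp : e q p by adj.
have dq := cocommon_closed uv vd ud Qr Qq rq dr.
have := cocommon_closed uv vd ud Qq Qp qp dq.
by rewrite (negPf (anti_nadj dp)).
Qed.

(** Since [u] and [v] are not twins, the auxiliary vertex [y] exists up to exchanging them. *)
Lemma cocommon_noP3 u v p q r : e u v ->
  cocommon u v p -> cocommon u v q -> cocommon u v r ->
  e p q -> e q r -> anti p r -> False.
Proof.
move=> uv Qp Qq Qr pq qr pr; have [w [wu wv]] := no_adjacent_twins uv.
have vu : e v u by adj.
have [uw|uw] := boolP (e u w); have [vw|vw] := boolP (e v w) => // _.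
  rewrite !(cocommonC u v) in Qp Qq Qr.
  by apply: (cocommon_noP3_aux vu _ uw Qp Qq Qr) => //; rewrite /anti eq_sym wv.
by apply: (cocommon_noP3_aux uv _ vw Qp Qq Qr) => //; rewrite /anti eq_sym wu.
Qed.

(** A [w] adjacent to [q] but not [p] either ends an induced path [p]-[q]-[w] of common
    non-neighbours, or is adjacent to [v] and contradicts [cocommon_closed]. *)
Lemma cocommon_twins u v p q w : e u v ->
  cocommon u v p -> cocommon u v q -> e p q ->
  anti u w -> anti p w -> anti q w.
Proof.
move=> uv Qp Qq pq uw pw; have qp : e q p by adj.
apply: contraT => nqw.
have qw : e q w.
  move: nqw; rewrite negb_and !negbK => /orP[/eqP qw|//].
  by move: (anti_nadj pw); rewrite -qw pq.
have [Qw|Qw] := boolP (cocommon u v w).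
  by case: (cocommon_noP3 uv Qp Qq Qw pq qw pw).
have vw := adj_of_not_cocommon uw Qw uv.
have wq : e w q by adj.
have := cocommon_closed uv vw uw Qq Qp qp wq.
by rewrite e_sym (negPf (anti_nadj pw)).
Qed.

Lemma cocommon_stable u v p q : e u v ->
  cocommon u v p -> cocommon u v q -> ~~ e p q.
Proof.
move=> uv Qp Qq; apply/negP=> pq.
have [up vp] := andP Qp; have [uq vq] := andP Qq.
have Qu : cocommon p q u by rewrite /cocommon asym up asym.
have Qv : cocommon p q v by rewrite /cocommon asym vp asym.
(* If [p] were adjacent to both vertices of a non-adjacent pair, it would be the middle of an
   excluded three-vertex path. *)
have [k Qk pk] : exists2 k, cocommon u v k & anti p k.
  have [x [y [Qx Qy xy]]] := cocommon_pair uv.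
  have [px|px] := boolP (anti p x); first by exists x.
  have [py|py] := boolP (anti p y); first by exists y.
  move: px py; rewrite 2!negb_and !negbK.
  case/orP=> [/eqP px|px]; case/orP=> [/eqP py|py].
  - by move: xy; rewrite -px -py antixx.
  - by move: xy; rewrite -px => /anti_nadj; rewrite py.
  - by move: xy; rewrite -py => /anti_nadj; rewrite e_sym px.
  have xp : e x p by adj.
  by case: (cocommon_noP3 uv Qx Qp Qy xp py xy).
have [uk vk] := andP Qk.
pose L := [pred w | anti u w && anti p w].
have Lk : L k by rewrite /= uk pk.
have nLu : ~~ L u by rewrite /= antixx.
have kM : k \in nonnbr p by rewrite inE.
have uM : u \in nonnbr p by rewrite inE asym.
have [a [b [aM bM /andP[ua pa] nLb ab]]] := nonnbr_connected kM uM Lk nLu.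
rewrite !inE in aM bM.
have ub : e u b.
  move: nLb; rewrite /= bM andbT; exact: adj_of_not_anti ua ab.
have ba : e b a by adj.
have [d [ad du db]] := extend ub ba ua.
have [pd|npd] := boolP (anti p d); last first.
  have pd := adj_of_not_anti pa ad npd; path5 p d a b u.
have ud : anti u d by rewrite asym.
have qa := cocommon_twins uv Qp Qq pq ua pa.
have qd := cocommon_twins uv Qp Qq pq ud pd.
(* Now the edge [p q] plays the part of [u v]: [a] and [d] are adjacent common non-neighbours of it,
   yet [b] distinguishes them. *)
have Qa : cocommon p q a by rewrite /cocommon pa.
have Qd : cocommon p q d by rewrite /cocommon pd.
have da : e d a by adj.
have := cocommon_twins pq Qd Qa da bM db.
by move/anti_nadj; rewrite ab.
Qed.

(** A third common non-neighbour would form a stable set of size 4 with [p], [q] and [u]. *)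
Lemma cocommon_two u v : e u v -> exists p q,
  [/\ cocommon u v p, cocommon u v q, anti p q &
      forall w, cocommon u v w -> w = p \/ w = q].
Proof.
move=> uv; have [p [q [Qp Qq pq]]] := cocommon_pair uv.
exists p, q; split=> // w Qw.
have [->|wp] := eqVneq w p; first by left.
have [->|wq] := eqVneq w q; first by right.
have pw : anti p w by rewrite /anti eq_sym wp (cocommon_stable uv Qp Qw).
have qw : anti q w by rewrite /anti eq_sym wq (cocommon_stable uv Qq Qw).
have [up _] := andP Qp; have [uq _] := andP Qq; have [uw _] := andP Qw.
by case: (no_stable4 up uq uw pq pw qw).
Qed.

End MinimalCounterexample.

(** * The complement is strongly regular *)

Section LocallyMoore.

Variables (T : finType) (h : rel T).
Hypotheses (h_sym : symmetric h) (h_irr : irreflexive h).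
Hypothesis h_two : forall u v, u != v -> ~~ h u v ->
  exists p q, h p q /\ forall w, h u w && h v w = (w == p) || (w == q).
Hypothesis h_K4 : forall a b c d,
  h a b -> h a c -> h a d -> h b c -> h b d -> h c d -> False.
(** With [h] the complement, this is [nonnbr_connected]. *)
Hypothesis h_link : forall u (P : pred T) x y, h u x -> h u y -> P x -> ~~ P y ->
  exists a b, [/\ h u a, h u b, P a, ~~ P b & ~~ h a b].
Hypothesis T_big : 3 < #|T|.

Definition nbr x : {set T} := [set y | h x y].
Definition codeg x y := #|nbr x :&: nbr y|.

Lemma codegC x y : codeg x y = codeg y x.
Proof. by rewrite /codeg setIC. Qed.

Lemma other_common u x y : x != y -> ~~ h x y -> h x u -> h y u ->
  exists s, [/\ h x s, h y s, h u s & forall w, h x w -> h y w -> w = u \/ w = s].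
Proof.
move=> xy nxy xu yu; have [p [q [pq cpq]]] := h_two xy nxy.
have /andP[xp yp] : h x p && h y p by rewrite cpq eqxx.
have /andP[xq yq] : h x q && h y q by rewrite cpq eqxx orbT.
have := cpq u; rewrite xu yu /= => /esym /orP[] /eqP uE.
  exists q; rewrite uE; split=> // w xw yw.
  by have := cpq w; rewrite xw yw => /esym /orP[] /eqP ->; [left | right].
exists p; rewrite uE; split=> //; first by rewrite h_sym.
move=> w xw yw.
by have := cpq w; rewrite xw yw => /esym /orP[] /eqP ->; [right | left].
Qed.

Lemma codeg_le u a b : h u a -> h u b -> a != b -> ~~ h a b ->
  codeg u a <= codeg u b.
Proof.
move=> ua ub a_b nab; have au : h a u by rewrite h_sym.
have bu : h b u by rewrite h_sym.
(* A common neighbour [t] of [u] and [a] is sent to the common neighbour, other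
   than [u], of [t] and [b]. *)
pose f t := if h t b then t
            else odflt t [pick s | [&& h t s, h b s, h u s & s != u]].
have fP t : t \in nbr u :&: nbr a -> ~~ h t b ->
    [&& h t (f t), h b (f t), h u (f t) & f t != u].
  rewrite !inE => /andP[ut at'] tb; rewrite /f (negPf tb).
  have tb_ : t != b by apply: contraNneq nab => <-.
  have tu : h t u by rewrite h_sym.
  have [s [ts bs us _]] := other_common tb_ tb tu bu.
  case: pickP => //= /(_ s); rewrite ts bs us /=.
  by rewrite (contraTneq _ us) // => ->; rewrite h_irr.
(* [t1] and [t2] are not adjacent, as there is no K4. If distinct and both moved to the same vertex,
   this would be their second common neighbour besides [u], namely [a]; but it is adjacent to
   [b]. *)
have finj : {in nbr u :&: nbr a &, injective f}.
  move=> t1 t2 D1 D2; have := fP t1 D1; have := fP t2 D2.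
  move: D1 D2; rewrite !inE => /andP[u1 a1] /andP[u2 a2].
  have n12 : h t1 t2 -> False by move=> h12; apply: (@h_K4 u a t1 t2).
  have [h1|h1] := boolP (h t1 b); have [h2|h2] := boolP (h t2 b).
  - by rewrite /f h1 h2.
  - move=> /(_ isT) /andP[h2f _] _ E; case: n12.
    by move: h2f; rewrite -E {1}/f h1 h_sym.
  - move=> _ /(_ isT) /andP[h1f _] E; case: n12.
    by move: h1f; rewrite E {1}/f h2.
  move=> /(_ isT) /and4P[h2f _ _ _] /(_ isT) /and4P[h1f bf _ fu] E.
  apply/eqP; apply: contraT => t12.
  have t1u : h t1 u by rewrite h_sym.
  have t2u : h t2 u by rewrite h_sym.
  have t1a : h t1 a by rewrite h_sym.
  have t2a : h t2 a by rewrite h_sym.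
  have [s [_ _ _ us]] := other_common t12 (introN idP n12) t1u t2u.
  have as_ : a = s.
    by case: (us a t1a t2a) => // ae; move: ua; rewrite ae h_irr.
  have fs : f t1 = s.
    have h2f1 : h t2 (f t1) by rewrite E.
    by case: (us _ h1f h2f1) => // fe; move: fu; rewrite fe eqxx.
  by move: nab; rewrite as_ -fs h_sym bf.
rewrite /codeg -(card_in_imset finj); apply: subset_leq_card.
apply/subsetP=> _ /imsetP[t tD ->]; rewrite !inE.
have [tb|tb] := boolP (h t b); last by have /and4P[_ -> -> _] := fP t tD tb.
by rewrite /f tb; move: tD; rewrite !inE => /andP[-> _]; rewrite h_sym.
Qed.

(** [codeg_le] in both directions gives equality across non-adjacent pairs, and [h_link] says that
    such pairs connect the neighbourhood of [u]. *)
Lemma codeg_link u a b : h u a -> h u b -> codeg u a = codeg u b.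
Proof.
move=> ua ub; apply/eqP; rewrite eq_sym; apply: contraT => ne.
pose P := [pred x | codeg u x == codeg u a].
have Pa : P a by rewrite /= eqxx.
have [x [y [ux uy Px nPy nxy]]] := h_link ua ub Pa ne.
have xy : x != y by apply: contraNneq nPy => <-.
case/negP: nPy; rewrite /= -(eqP Px) eqn_leq !codeg_le //.
  by rewrite eq_sym.
by rewrite h_sym.
Qed.

Lemma codeg_const u a w b : h u a -> h w b -> codeg u a = codeg w b.
Proof.
move=> ua wb; have [uw|uw] := eqVneq u w.
  by rewrite uw in ua *; apply: codeg_link.
have [huw|huw] := boolP (h u w).
  by rewrite (codeg_link ua huw) codegC; apply: codeg_link; rewrite // h_sym.
have [p [q [_ cpq]]] := h_two uw huw.
have /andP[up wp] : h u p && h w p by rewrite cpq eqxx.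
rewrite (codeg_link ua up) codegC (@codeg_link p u w); try by rewrite h_sym.
by rewrite codegC; apply: codeg_link.
Qed.

Lemma codeg_nonadj u v : u != v -> ~~ h u v -> codeg u v = 2.
Proof.
move=> uv nuv; have [p [q [pq cpq]]] := h_two uv nuv.
rewrite /codeg; have -> : nbr u :&: nbr v = [set p; q].
  by apply/setP=> w; rewrite !inE cpq.
rewrite cards2; suff -> : p != q by [].
by apply: contraTneq pq => ->; rewrite h_irr.
Qed.

Lemma has_nbr u : exists a, h u a.
Proof.
have [v vu] : exists v, v != u.
  have /card_gt1P[x [y [_ _ xy]]] : 1 < #|T| by apply: leq_trans T_big.
  have [xu|xu] := eqVneq x u; last by exists x.
  by exists y; rewrite -xu eq_sym.
have [uv|uv] := boolP (h u v); first by exists v.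
rewrite eq_sym in vu; have [p [q [_ cpq]]] := h_two vu uv.
by exists p; have := cpq p; rewrite eqxx => /andP[].
Qed.

Lemma degree_codeg u a : h u a -> #|nbr u| = (codeg u a ^ 2).+1.
Proof.
move=> ua; set k := codeg u a.
have au : h a u by rewrite h_sym.
(* In the neighbourhood of [u], each non-neighbour of [a] is reached from [a]
   by exactly one path of length 2. *)
have count : \sum_(b in nbr u) #|nbr u :&: nbr a :&: nbr b| = k * k.
  transitivity (\sum_(t in nbr u :&: nbr a) codeg u t); last first.
    rewrite (eq_bigr (fun=> k)) ?sum_nat_const // => t.
    by rewrite !inE => /andP[ut _]; apply: codeg_link.
  under eq_bigr => b _ do rewrite -sum1_card.
  under [RHS]eq_bigr => t _ do rewrite /codeg -sum1_card.
  rewrite (exchange_big_dep (mem (nbr u :&: nbr a))) /=; last first.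
    by move=> b t _; rewrite inE => /andP[].
  apply: eq_bigr => t tD; apply: eq_bigl => b.
  by move: tD; rewrite !inE => /andP[-> ->]; rewrite (h_sym b).
have aN : a \in nbr u by rewrite inE.
rewrite (bigD1 a) //= in count.
have triv : nbr u :&: nbr a :&: nbr a = nbr u :&: nbr a by rewrite -setIA setIid.
rewrite triv -/(codeg u a) -/k in count.
(* A neighbour [b] of [a] contributes 0, as there is no K4; a non-neighbour contributes 1, its
   second common neighbour with [a]. *)
have rest : \sum_(b in nbr u | b != a) #|nbr u :&: nbr a :&: nbr b| =
    #|nbr u :\ a :\: nbr a|.
  rewrite -sum1_card big_mkcond [RHS]big_mkcond; apply: eq_bigr => b _.
  rewrite !inE; have [ub|] := boolP (h u b); last by rewrite !andbF.
  rewrite /= !andbT; have [->|ba] := eqVneq b a; first by rewrite andbF.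
  have [ab|ab] /= := boolP (h a b).
    apply/eqP; rewrite cards_eq0; apply/eqP/setP => t; rewrite !inE.
    apply/negP=> /andP[/andP[ut at'] bt]; exact: (@h_K4 u a b t).
  have ab_ : a != b by rewrite eq_sym.
  have bu : h b u by rewrite h_sym.
  have [s [as_ bs us only]] := other_common ab_ ab au bu.
  apply/eqP/cards1P; exists s; apply/setP=> t; rewrite !inE.
  apply/idP/eqP => [/andP[/andP[ut at'] bt]|->]; last by rewrite us as_ bs.
  by case: (only t at' bt) => // tu; move: ut; rewrite tu h_irr.
rewrite rest in count.
have := cardsID (nbr a) (nbr u :\ a).
have -> : (nbr u :\ a) :&: nbr a = nbr u :&: nbr a.
  apply/setP=> t; rewrite !inE; have [->|//] := eqVneq t a.
  by rewrite h_irr !andbF.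
have := cardsD1 a (nbr u); rewrite aN -/(codeg u a) -/k -mulnn => -> <-.
by rewrite count.
Qed.

(** The last equation counts walks of length 2 from a fixed vertex by their end: the vertex itself,
    a neighbour, or a non-neighbour. *)
Lemma strongly_regular : exists k,
  [/\ forall u v, h u v -> codeg u v = k,
      forall u, #|nbr u| = (k ^ 2).+1 &
      ((k ^ 2).+1) ^ 2 = (k ^ 2).+1 + k * (k ^ 2).+1 + 2 * (#|T| - (k ^ 2).+2)].
Proof.
have [x0 _] : exists x : T, true.
  by case: (pickP T) => [x|T0]; [exists x | move: T_big; rewrite (eq_card0 T0)].
have [a0 xa0] := has_nbr x0; pose k := codeg x0 a0.
have ck u v : h u v -> codeg u v = k by move=> uv; apply: codeg_const.
have deg u : #|nbr u| = (k ^ 2).+1.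
  by have [a ua] := has_nbr u; rewrite (degree_codeg ua) ck.
exists k; split=> //.
have count : \sum_v codeg x0 v = (k ^ 2).+1 ^ 2.
  transitivity (\sum_(t in nbr x0) #|nbr t|).
    under eq_bigr => b _ do rewrite /codeg -sum1_card.
    under [RHS]eq_bigr => t _ do rewrite -sum1_card.
    rewrite (exchange_big_dep (mem (nbr x0))) /=; last first.
      by move=> b t _; rewrite inE => /andP[].
    apply: eq_bigr => t tD; apply: eq_bigl => b.
    by move: tD; rewrite !inE => ->; rewrite (h_sym b).
  rewrite (eq_bigr (fun=> (k ^ 2).+1)) => [|t _]; last exact: deg.
  by rewrite sum_nat_const deg mulnn.
rewrite -count (bigD1 x0) //= (bigID (h x0)) /= {1}/codeg setIid deg addnA.
congr (_ + _ + _).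
  rewrite (eq_bigl (mem (nbr x0))) => [|v]; last first.
    rewrite !inE; have [->|] := eqVneq v x0; last by [].
    by rewrite h_irr.
  rewrite (eq_bigr (fun=> k)) => [|v]; last by rewrite /= inE => /ck.
  by rewrite sum_nat_const deg mulnC.
rewrite (eq_bigr (fun=> 2)) => [|v /andP[vx nv]]; last first.
  by rewrite codeg_nonadj // eq_sym.
rewrite sum_nat_const mulnC; congr (2 * _).
rewrite -(deg x0) -[LHS](addnK #|x0 |: nbr x0|).
have x0N : x0 \notin nbr x0 by rewrite inE h_irr.
rewrite cardsU1 x0N add1n; congr (_ - _).
rewrite -(cardC (mem (x0 |: nbr x0))) addnC cardsU1 x0N; congr (_ + _).
by apply: eq_card => v; rewrite !inE negb_or.
Qed.

End LocallyMoore.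

(** * Excluding the strongly regular graphs *)

Section TraceMultiplicity.

Local Open Scope ring_scope.

(** In a full-rank factorization [E = C R] idempotence forces [R C = 1], and the trace is cyclic. *)
Lemma trace_idempotent (F : fieldType) n (E : 'M[F]_n) :
  E *m E = E -> \tr E = (\rank E)%:R.
Proof.
have retract r (C : 'M[F]_(n, r)) (R : 'M[F]_(r, n)) :
    row_full C -> row_free R -> C *m R *m (C *m R) = C *m R -> R *m C = 1%:M.
  move=> /row_fullP[B BC] Rfree CR; apply: (row_free_inj Rfree).
  by move/(congr1 (mulmx B)): CR; rewrite !mulmxA BC !mul1mx.
have := retract _ _ _ (col_base_full E) (row_base_free E).
rewrite mulmx_base => RC /RC RC1.
by rewrite -{1}(mulmx_base E) mxtrace_mulC RC1 mxtrace1.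
Qed.

(** Off the constant vector the eigenvalues of [A] are [(b + s)/2] and [(b - s)/2], with
    multiplicities [r] and [n - r]; [d] belongs to the constant vector. *)
Lemma trace_two_eigenvalues (F : fieldType) n (A : 'M[F]_n.+1) (a b c d s : F) :
  let J := const_mx 1 : 'M[F]_n.+1 in
  n.+1%:R != 0 :> F -> 2 != 0 :> F -> s != 0 -> s ^+ 2 = b ^+ 2 + 4 * a ->
  A *m A = a%:M + b *: A + c *: J -> A *m J = d *: J -> J *m A = d *: J ->
  exists r : nat, 2 * \tr A - b * n%:R - 2 * d = s * (2 * r%:R - n%:R).
Proof.
move=> J n0 two0 s0 s2 AA AJ JA.
have JJ : J *m J = n.+1%:R *: J.
  apply/matrixP=> i j; rewrite !mxE mulr1 -[RHS]mulr1.
  rewrite (eq_bigr (fun=> 1)) ?sumr_const ?card_ord ?mulr1 // => k _.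
  by rewrite !mxE mulr1.
have trJ : \tr J = n.+1%:R.
  rewrite /mxtrace (eq_bigr (fun=> 1)) ?sumr_const ?card_ord // => k _.
  by rewrite mxE.
pose P : 'M[F]_n.+1 := 1%:M - n.+1%:R^-1 *: J.
pose C : 'M[F]_n.+1 := 2 *: A - b%:M.
have PJ : P *m J = 0.
  by rewrite mulmxBl mul1mx -scalemxAl JJ scalerA mulVf // scale1r subrr.
have CJ : C *m J = (2 * d - b) *: J.
  by rewrite mulmxBl -scalemxAl AJ mul_scalar_mx scalerA -scalerBl.
have JC : J *m C = (2 * d - b) *: J.
  by rewrite mulmxBr -scalemxAr JA mul_mx_scalar scalerA -scalerBl.
have PCE : P *m C = C - n.+1%:R^-1 *: (J *m C).
  by rewrite mulmxBl mul1mx -scalemxAl.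
have PC : P *m C = C *m P.
  rewrite PCE; have -> : C *m P = C - n.+1%:R^-1 *: (C *m J).
    by rewrite mulmxBr mulmx1 -scalemxAr.
  by rewrite CJ JC.
have PP : P *m P = P.
  by rewrite {2}/P mulmxBr mulmx1 -scalemxAr PJ scaler0 subr0.
have CC : C *m C = (s ^+ 2)%:M + (4 * c) *: J.
  rewrite mulmxBl !mulmxBr -!scalemxAl -!scalemxAr AA mul_mx_scalar.
  rewrite !mul_scalar_mx s2.
  apply/matrixP=> i j; rewrite !mxE; case: (i == j); rewrite /= ?mulr1n ?mulr0n; ring.
have PCC : P *m C *m C = s ^+ 2 *: P.
  by rewrite -mulmxA CC mulmxDr -scalemxAr PJ scaler0 addr0 mul_mx_scalar.
have trP : \tr P = n%:R.
  by rewrite linearB linearZ /= trJ mxtrace1 mulVf // -natr1 addrK.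
have trPC : \tr (P *m C) = 2 * \tr A - b * n%:R - 2 * d.
  rewrite PCE JC linearB !linearZ /= trJ.
  rewrite linearB linearZ /= mxtrace_scalar mulrA mulrAC mulVf // mul1r.
  by rewrite -mulr_natr -natr1; ring.
clearbody P C.
(* [E] is the projection onto one of the two eigenspaces of [A] orthogonal to
   the constant vector; its trace is the dimension of that eigenspace. *)
pose E := (2 * s)^-1 *: (P *m (C + s%:M)).
have ts0 : 2 * s != 0 by rewrite mulf_neq0.
have EE : E *m E = E.
  rewrite -scalemxAl -scalemxAr scalerA.
  have -> : P *m (C + s%:M) *m (P *m (C + s%:M)) = (2 * s) *: (P *m (C + s%:M)).
    have -> : P *m (C + s%:M) = P *m C + s *: P by rewrite mulmxDr mul_mx_scalar.
    have PCP : P *m C *m P = P *m C by rewrite -mulmxA -PC mulmxA PP.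
    rewrite mulmxDl !mulmxDr -!scalemxAl -!scalemxAr !mulmxA !PCP !PP PCC.
    by apply/matrixP=> i j; rewrite !mxE; ring.
  by rewrite scalerA -mulrA mulVf // mulr1.
exists (\rank E); have := trace_idempotent EE.
rewrite linearZ /= mulmxDr mul_mx_scalar linearD linearZ /= => trE.
rewrite -trPC -trE trP; field.
by rewrite s0 two0.
Qed.

End TraceMultiplicity.


(** * Arithmetic of the parameters *)

Lemma dvdn_mul_split d m n : 0 < d -> d %| m * n ->
  exists a b, [/\ a %| m, b %| n & d = a * b].
Proof.
move=> d0 dmn; exists (gcdn d m), (d %/ gcdn d m).
have g0 : 0 < gcdn d m by rewrite gcdn_gt0 d0.
rewrite dvdn_gcdr [gcdn d m * _]mulnC divnK ?dvdn_gcdl //; split=> //.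
have cop : coprime (d %/ gcdn d m) (m %/ gcdn d m).
  rewrite /coprime -(eqn_pmul2r g0) muln_gcdl !divnK ?dvdn_gcdl ?dvdn_gcdr //.
  by rewrite mul1n.
rewrite -(Gauss_dvdr _ cop) -(dvdn_pmul2r g0) divnK ?dvdn_gcdl //.
by rewrite mulnAC divnK ?dvdn_gcdr.
Qed.

Lemma of_nat_expn m n : N.of_nat (m ^ n) = N.pow (N.of_nat m) (N.of_nat n).
Proof.
elim: n => // n IHn.
by rewrite expnS -multE Nat2N.inj_mul IHn Nat2N.inj_succ N.pow_succ_r'.
Qed.

(** A finite check over 81 exponent triples, run in binary arithmetic because the numbers are too
    large for unary ones. *)
Lemma square_divisor_small k i j l q : i <= 8 -> j <= 2 -> l <= 2 ->
  5 * k = 2 ^ i * (7 ^ j * 41 ^ l) + 4 -> k * (2 ^ i * (7 ^ j * 41 ^ l)) = q ^ 2 ->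
  k <= 4.
Proof.
pose check i j l := let D := (2 ^ N.of_nat i * (7 ^ N.of_nat j * 41 ^ N.of_nat l))%num in
  let k := N.div (D + 4) 5 in
  [|| ~~ N.eqb (5 * k) (D + 4),
      ~~ N.eqb (N.sqrt (k * D) * N.sqrt (k * D)) (k * D) | N.leb k 4].
have all_ok : all (fun i => all (fun j => all (check i j) (iota 0 3)) (iota 0 3)) (iota 0 9).
  by vm_compute.
move=> i8 j2 l2 Dk Dq.
have := allP (allP (allP all_ok i _) j _) l; rewrite !mem_iota !ltnS i8 j2 l2.
move=> /(_ isT isT isT); rewrite /check.
move: Dk Dq => /(congr1 N.of_nat) Dk /(congr1 N.of_nat) Dq.
rewrite -multE -plusE !(Nat2N.inj_mul, Nat2N.inj_add, of_nat_expn) in Dk Dq.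
rewrite -[N.of_nat 7]/7%num -[N.of_nat 41]/41%num in Dk Dq.
rewrite -[N.of_nat 5]/5%num -[N.of_nat 4]/4%num -[N.of_nat 2]/2%num in Dk Dq.
set D := (2 ^ _ * _)%num in Dk Dq *.
have -> : N.div (D + 4) 5 = N.of_nat k.
  by rewrite -Dk N.mul_comm N.div_mul.
rewrite Dk N.eqb_refl Dq.
have -> : N.pow (N.of_nat q) 2 = (N.of_nat q * N.of_nat q)%num.
  by rewrite N.pow_2_r.
rewrite N.sqrt_square N.eqb_refl /= => /N.leb_le; lia.
Qed.

(* [N] is the number of vertices minus 1, [m + 2] is the parameter k, and [t] is
   the difference of the two eigenvalue multiplicities. *)
Lemma srg_parameters m N t : odd t = odd N ->
  2 * N = (m.+2 ^ 2 + 1) * (m ^ 2 + 3 * m + 4) ->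
  (m * N + 2 * (m.+2 ^ 2 + 1)) ^ 2 = m.+2 * (5 * m + 6) * t ^ 2 -> False.
Proof.
set d := m.+2 ^ 2 + 1; set D := 5 * m + 6; set w := m ^ 2 + m + 2.
move=> par N2 eqt.
have D0 : 0 < D by rewrite /D addn_gt0 orbT.
(* Substituting for [2 * N], twice the base of the left-hand square factors as [d * m.+2 * w]. *)
have eqX : (d * m.+2 * w) ^ 2 = 4 * (m.+2 * D * t ^ 2).
  rewrite -eqt -[4]/(2 ^ 2) -expnMn; congr (_ ^ 2).
  by rewrite mulnDr mulnCA N2 /w -addn2; ring.
have X0 : 0 < d * m.+2 * w by rewrite /d /w !muln_gt0 !addn_gt0 !orbT.
have [q kDq] : exists q, m.+2 * D = q ^ 2.
  have sq : (d * m.+2 * w) ^ 2 * (m.+2 * D) = (2 * (m.+2 * D) * t) ^ 2.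
    by rewrite eqX; ring.
  have /dvdnP[q qE] : d * m.+2 * w %| 2 * (m.+2 * D) * t.
    by rewrite -(@dvdn_pexp2r _ _ 2) // -sq dvdn_mulr.
  exists q.
  have X2 : 0 < (d * m.+2 * w) ^ 2 by rewrite expn_gt0 X0.
  by apply/eqP; rewrite -(eqn_pmul2l X2) sq qE expnMn mulnC.
have eqd : d ^ 2 * m.+2 * w ^ 2 = 4 * D * t ^ 2.
  have k0 : 0 < m.+2 by [].
  apply/eqP; rewrite -(eqn_pmul2l k0); apply/eqP.
  have -> : m.+2 * (4 * D * t ^ 2) = 4 * (m.+2 * D * t ^ 2) by ring.
  by rewrite -eqX; ring.
have Ddvd : D %| 2 ^ 8 * (7 ^ 2 * 41 ^ 2).
  have -> : 2 ^ 8 * (7 ^ 2 * 41 ^ 2) = 41 ^ 2 * (4 * 56 ^ 2) by rewrite -[56]/(2 ^ 3 * 7); ring.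
  (* With k = m + 2, modulo D we have 5 k = 4, hence 25 d = 41 and 25 w = 56;
     multiply [eqd] by 5 ^ 9. *)
  suff : (D%:Z %| (41 ^+ 2 * (4 * 56 ^+ 2))%R)%Z by rewrite dvdzE abszM abszX abszM abszX.
  pose x : int := D%:Z.
  pose y1 : int := (x * (x + 8) ^+ 2 + 82 * (x + 8))%R.
  pose y3 : int := (x * (x - 7) ^+ 2 + 112 * (x - 7))%R.
  pose Q : int := (y1 * (x + 4) * (x * y3 + 56 ^+ 2) +
     41 ^+ 2 * (x * y3 + 56 ^+ 2 + 4 * y3))%R.
  have -> : (41 ^+ 2 * (4 * 56 ^+ 2) =
      5 ^+ 9 * (d ^ 2 * m.+2 * w ^ 2)%N%:Z - x * Q :> int)%R.
    rewrite /Q /y1 /y3 /x /d /w /D; ring.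
  rewrite eqd; apply: rpredB; last by rewrite dvdz_mulr.
  by rewrite !PoszM; apply/dvdz_mull/dvdz_mulr/dvdz_mull.
have [a [b [a8 b2 Dab]]] := dvdn_mul_split D0 Ddvd.
have b0 : 0 < b by move: D0; rewrite Dab muln_gt0 => /andP[].
have [b1 [b3 [b17 b41 bE]]] := dvdn_mul_split b0 b2.
move/(dvdn_pfactor _ _ (isT : prime 2)): a8 => [i i8 aE].
move/(dvdn_pfactor _ _ (isT : prime 7)): b17 => [j j2 b1E].
move/(dvdn_pfactor _ _ (isT : prime 41)): b41 => [l l2 b3E].
have k4 : m.+2 <= 4.
  apply: (@square_divisor_small m.+2 i j l q i8 j2 l2); rewrite -b1E -b3E -bE -aE -Dab //.
  rewrite /D; lia.
have [k2|[k3|k4E]] : m = 0 \/ m = 1 \/ m = 2 by lia.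
- move: kDq; rewrite /D k2; have [|q4] := leqP q 3; first by case: q => [|[|[|[|]]]].
  by move=> kDq; move: q4; rewrite -(@leq_exp2r _ _ 2) // -kDq.
- move: kDq; rewrite /D k3; have [|q6] := leqP q 5.
    by case: q => [|[|[|[|[|[|]]]]]].
  by move=> kDq; move: q6; rewrite -(@leq_exp2r _ _ 2) // -kDq.
(* For k = 2 and 3 the product [m.+2 * D] is 12 or 33, not a square. For k = 4 it is 64, so [t = 34]
   and [N = 119], of different parity. *)
rewrite /d /D k4E in N2 eqt.
have NE : N = 119 by move: N2; rewrite -[_ * _ in RHS]/(2 * 119) => /eqP; rewrite eqn_pmul2l // => /eqP.
have /eqP : (8 * 34) ^ 2 = (8 * t) ^ 2.
  by rewrite [RHS]expnMn -[8 ^ 2]/(4 * (5 * 2 + 6)) -eqt NE.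
rewrite eqn_exp2r // eqn_pmul2l // => /eqP tE.
by move: par; rewrite -tE NE.
Qed.

Lemma no_strongly_regular (T : finType) (h : rel T) m :
  symmetric h -> irreflexive h ->
  (forall u v, h u v -> codeg h u v = m.+2) ->
  (forall u v, u != v -> ~~ h u v -> codeg h u v = 2) ->
  (forall u, #|nbr h u| = (m.+2 ^ 2).+1) ->
  ((m.+2 ^ 2).+1) ^ 2 = (m.+2 ^ 2).+1 + m.+2 * (m.+2 ^ 2).+1 +
    2 * (#|T| - (m.+2 ^ 2).+2) -> False.
Proof.
move=> h_sym h_irr adj nonadj deg param.
have [N TN] : exists N, #|T| = N.+1.
  exists #|T|.-1; rewrite prednK //; case: (posnP #|T|) => // T0.
  by move: param; rewrite T0 sub0n muln0 addn0; nia.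
have N2 : 2 * N = (m.+2 ^ 2 + 1) * (m ^ 2 + 3 * m + 4).
  move: param; rewrite TN subSS => param.
  have dN : m.+2 ^ 2 + 1 <= N.
    rewrite leqNgt; apply/negP=> Nd; move: param.
    by rewrite (_ : N - _ = 0) ?muln0 ?addn0; [nia | lia].
  have [x Nx] : exists x, N = m.+2 ^ 2 + 1 + x by exists (N - (m.+2 ^ 2 + 1)); lia.
  by move: param; rewrite Nx (_ : _ - _ = x); [nia | lia].
pose f (i : 'I_N.+1) : T := enum_val (cast_ord (esym TN) i).
have f_inj : injective f by move=> i j /enum_val_inj /cast_ord_inj.
have f_bij : bijective f by apply: inj_card_bij f_inj _; rewrite card_ord TN.
pose A : 'M[algC]_N.+1 := (\matrix_(i, j) (h (f i) (f j))%:R)%R.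
pose J : 'M[algC]_N.+1 := const_mx 1%R.
have sum_card (B : {set T}) : (\sum_i (f i \in B)%:R = #|B|%:R :> algC)%R.
  by rewrite -sum1_card natr_sum [RHS]big_mkcond [RHS](reindex f) //=;
    [apply: eq_bigr => l _; case: (_ \in _) | apply: onW_bij].
have AJ : (A *m J = ((m.+2 ^ 2).+1)%:R *: J)%R.
  apply/matrixP=> i j; rewrite !mxE mulr1 -(deg (f i)) -sum_card.
  by apply: eq_bigr => l _; rewrite !mxE mulr1 inE.
have JA : (J *m A = ((m.+2 ^ 2).+1)%:R *: J)%R.
  apply/matrixP=> i j; rewrite !mxE mulr1 -(deg (f j)) -sum_card.
  by apply: eq_bigr => l _; rewrite !mxE mul1r inE h_sym.
have AAE i j : ((A *m A) i j = (codeg h (f i) (f j))%:R)%R.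
  rewrite mxE /codeg -sum_card; apply: eq_bigr => l _.
  by rewrite !mxE !inE (h_sym (f j)) -natrM mulnb.
(* With k = m + 2, the entries of [A *m A] are k^2 + 1 on the diagonal, k on edges and 2 elsewhere;
   subtracting 2 everywhere leaves [a] and [b]. *)
pose a : algC := (m.+2%:R ^+ 2 - 1)%R.
pose b : algC := m%:R%R.
have AA : (A *m A = a%:M + b *: A + 2 *: J)%R.
  apply/matrixP=> i j; rewrite AAE !mxE; have [<-|ij] := eqVneq i j.
    rewrite /codeg setIid deg h_irr mulr0 mulr1n /a -natr1 natrX; ring.
  have fij : f i != f j by rewrite (inj_eq f_inj).
  rewrite mulr0n add0r; case: (boolP (h _ _)) => hij.
    by rewrite adj // -addn2 natrD /b /= !mulr1.
  by rewrite nonadj //= mulr0 add0r mulr1.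
have trA : (\tr A = 0)%R.
  by rewrite /mxtrace big1 // => i _; rewrite mxE h_irr.
pose s := sqrtC ((m.+2 * (5 * m + 6))%:R : algC).
have s2 : (s ^+ 2 = b ^+ 2 + 4 * a)%R.
  by rewrite sqrtCK /a /b natrM natrD natrM -[m.+2]addn2 natrD; ring.
have s0 : s != 0%R by rewrite sqrtC_eq0 pnatr_eq0 muln_eq0 addn_eq0 andbF.
have n0 : (N.+1%:R != 0 :> algC)%R by rewrite pnatr_eq0.
have two0 : (2 != 0 :> algC)%R by rewrite pnatr_eq0.
have [r] := trace_two_eigenvalues n0 two0 s0 s2 AA AJ JA.
rewrite trA mulr0 sub0r => rE.
(* The multiplicities are [r] and [N - r], so their difference has the parity of [N]. *)
pose x : int := ((2 * r)%N%:Z - N%:Z)%R; pose t := `|x|%N.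
apply: (@srg_parameters m N t) => //.
  by rewrite /t /x; lia.
apply/eqP; rewrite -(eqr_nat algC); apply/eqP.
have tE : ((t ^ 2)%:R = (2 * r%:R - N%:R) ^+ 2 :> algC)%R.
  have -> : (2 * r%:R - N%:R = x%:~R :> algC)%R.
    by rewrite rmorphB /= -!pmulrn natrM.
  by rewrite -rmorphXn /= -(ger0_norm (sqr_ge0 x)) -abszE abszX.
rewrite natrM tE -[X in (X * _)%R](sqrtCK (m.+2 * (5 * m + 6))%:R) -/s -exprMn -rE.
by rewrite natrX !natrD !natrM /b -[(m.+2 ^ 2).+1]addn1 natrD; ring.
Qed.

(** * The theorem *)

Lemma no_minimal_counterexample (T : finType) (e : rel T) :
  symmetric e -> irreflexive e -> no_induced_path5 e ->
  cut_connected e setT -> stable_triple e setT -> ~ dominating_end e setT ->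
  (forall (S : {set T}) x, x \notin S ->
    cut_connected e S -> stable_triple e S -> dominating_end e S) -> False.
Proof.
move=> e_sym e_irr P5 conn triple bad IH.
have a_sym : symmetric (anti e) := anti_sym e_sym.
have a_irr : irreflexive (anti e) := antixx e.
have two u v : u != v -> ~~ anti e u v -> exists p q, anti e p q /\
    forall w, anti e u w && anti e v w = (w == p) || (w == q).
  move=> uv; rewrite /anti uv negbK => euv.
  have [p [q [Qp Qq pq only]]] := cocommon_two e_sym e_irr P5 conn triple bad IH euv.
  exists p, q; split=> // w; apply/idP/orP => [Qw|[] /eqP -> //].
  by case: (only w Qw) => ->; [left | right].
have K4 a b c d : anti e a b -> anti e a c -> anti e a d -> anti e b c ->
    anti e b d -> anti e c d -> False.
  exact: (no_stable4 e_sym P5 conn bad IH).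
have link u (P : pred T) x y : anti e u x -> anti e u y -> P x -> ~~ P y ->
    exists a b, [/\ anti e u a, anti e u b, P a, ~~ P b & ~~ anti e a b].
  move=> ux uy Px nPy.
  have xM : x \in nonnbr e u by rewrite inE.
  have yM : y \in nonnbr e u by rewrite inE.
  have [a [b [aM bM Pa nPb ab]]] := nonnbr_connected e_sym P5 conn bad xM yM Px nPy.
  by rewrite !inE in aM bM; exists a, b; rewrite /anti ab andbF.
have big : 3 < #|T|.
  have [x [y [_ [_ [/anti_neq xy _ _]]]]] := triple.
  have yx : ~~ pred1 x y by rewrite /= eq_sym.
  have [u [v [_ _ _ _ uv]]] := conn (pred1 x) x y (in_setT x) (in_setT y) (eqxx x) yx.
  have [p [q [/andP[up vp] /andP[uq vq] pq _]]] :=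
    cocommon_two e_sym e_irr P5 conn triple bad IH uv.
  have us : uniq [:: u; v; p; q].
    rewrite /= !inE !negb_or (anti_neq up) (anti_neq vp) (anti_neq uq).
    rewrite (anti_neq vq) (anti_neq pq) !andbT.
    by apply: contraTneq uv => ->; rewrite e_irr.
  by apply: leq_trans (max_card (mem [:: u; v; p; q])); rewrite (card_uniqP us).
have [k [adj deg param]] := strongly_regular a_sym a_irr two K4 link big.
have nonadj := codeg_nonadj a_irr two.
(* For k = 0 or 1 the walk count leaves at most 2 or 3 vertices. *)
case: k => [|[|m]] in adj deg param.
- by move: param big; rewrite exp0n // exp1n mul0n; lia.
- by move: param big; rewrite exp1n mul1n -mulnn; lia.
exact: no_strongly_regular a_sym a_irr adj nonadj deg param.
Qed.

(** Makes the conclusion decidable, so that it can be proved by contradiction. *)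
Lemma dominating_endP (T : finType) (e : rel T) (S : {set T}) :
  reflect (dominating_end e S)
    [exists a in S, exists b in S, exists c in S,
      [&& e a b, e b c, anti e a c & [forall v in S, e c v ==> e v a || e v b]]].
Proof.
apply: (iffP exists_inP) => [[a aS /exists_inP[b bS /exists_inP[c cS]]]|].
  case/and4P=> ab bc ac /forall_inP dom; exists a, b, c; split=> //; split=> //.
  by move=> v vS; apply/implyP/dom.
case=> a [b [c [[aS bS cS] [ab bc ac dom]]]].
exists a => //; apply/exists_inP; exists b => //; apply/exists_inP; exists c => //.
rewrite ab bc ac; apply/forall_inP => v vS; apply/implyP; exact: dom.
Qed.

Lemma dominating_end_exists n (T : finType) (e : rel T) : #|T| <= n ->
  symmetric e -> irreflexive e -> no_induced_path5 e ->
  cut_connected e setT -> stable_triple e setT -> dominating_end e setT.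
Proof.
elim: n => [|n IHn] in T e *.
  by move=> T0 _ _ _ _ [x _]; move: T0; rewrite leqNgt (cardD1 x).
move=> Tn e_sym e_irr P5 conn triple; apply/dominating_endP; apply: contraT => nodom.
have bad : ~ dominating_end e setT := elimN (dominating_endP e setT) nodom.
exfalso.
apply: (no_minimal_counterexample e_sym e_irr P5 conn triple bad).
move=> S x xS connS [x1 [x2 [x3 [[S1 S2 S3] [a12 a13 a23]]]]].
pose U : finType := {y | y \in S}.
pose e' : rel U := relpre val e.
have Un : #|U| <= n.
  rewrite card_sig -ltnS; apply: leq_trans Tn; apply: proper_card.
  by apply/properP; split; [apply/subsetP | exists x].
have connU : cut_connected e' setT.
  (* [P] is extended by false outside [S]; only its values on [S] matter. *)
  move=> P u v _ _ Pu nPv; pose P' z := oapp P false (insub z).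
  have P'E w : P' (val w) = P w by rewrite /P' valK.
  have P'u : P' (val u) by rewrite P'E.
  have nP'v : ~~ P' (val v) by rewrite P'E.
  have [a [b [aS bS P'a nP'b ab]]] := connS P' _ _ (valP u) (valP v) P'u nP'v.
  by exists (Sub a aS), (Sub b bS); rewrite !in_setT -!P'E.
have tripleU : stable_triple e' setT.
  by exists (Sub x1 S1), (Sub x2 S2), (Sub x3 S3); rewrite !in_setT.
have [|||a [b [c [_ [ab bc ac dom]]]]] := IHn U e' Un _ _ _ connU tripleU.
- by move=> u v; apply: e_sym.
- by move=> u; apply: e_irr.
- by move=> a b c d f; apply: P5.
exists (val a), (val b), (val c); split; first by split; apply: valP.
split=> // v vS; exact: (dom (Sub v vS) (in_setT _)).
Qed.

Lemma P5_free_no_induced_path5 (T : finType) (e : rel T) :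
  symmetric e -> irreflexive e -> P5_free e -> no_induced_path5 e.
Proof.
move=> e_sym e_irr free a b c d f ab bc cd df nac nad naf nbd nbf ncf.
pose s := [:: a; b; c; d; f]; pose S := [set x in s].
(* Two of the vertices are distinct as soon as a third one is adjacent to exactly one of them. *)
have us : uniq s.
  have nfb : ~~ e f b by rewrite e_sym.
  have nca : ~~ e c a by rewrite e_sym.
  have nda : ~~ e d a by rewrite e_sym.
  have nfa : ~~ e f a by rewrite e_sym.
  have ba : e b a by rewrite e_sym.
  have cb : e c b by rewrite e_sym.
  have irr x : ~~ e x x by rewrite e_irr.
  rewrite /= !inE !negb_or (adj_neq ab (irr b)) (adj_neq bc (irr c)).
  rewrite (adj_neq cd (irr d)) (adj_neq df (irr f)) [a == c]eq_sym [a == d]eq_sym.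
  by rewrite (adj_neq cd nad) (adj_neq df naf) (adj_neq ab nfb) (adj_neq ba nda)
    (adj_neq ba nfa) (adj_neq cb nfb).
have mem_nth_s (i : 'I_5) : nth a s i \in S by rewrite inE mem_nth.
pose g (i : 'I_5) : {x | x \in S} := Sub (nth a s i) (mem_nth_s i).
have g_inj : injective g.
  move=> i j /(congr1 val) /= /eqP; rewrite nth_uniq // => /eqP; exact: val_inj.
have [k gK kK] : bijective g.
  apply: inj_card_bij g_inj _; rewrite card_ord card_sig.
  by rewrite cardsE (card_uniqP us).
apply: (free S); exists k; split; first by exists g.
move=> x y; rewrite -{2}(kK x) -{2}(kK y) /induced_subgraph /=.
have e0 := (ab, bc, cd, df, negPf nac, negPf nad, negPf naf, negPf nbd,
  negPf nbf, negPf ncf).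
have e1 := (e_sym b a, e_sym c a, e_sym d a, e_sym f a, e_sym c b, e_sym d b,
  e_sym f b, e_sym d c, e_sym f c, e_sym f d).
case: (k x) => [[|[|[|[|[|//]]]]] ?]; case: (k y) => [[|[|[|[|[|//]]]]] ?];
  by rewrite /path_graph /= ?e_irr ?e0 ?e1 ?e0.
Qed.

Theorem theorem1p2 (T : finType) (e : rel T)
    (e_sym : symmetric e) (e_irr : irreflexive e)
    (e_conn : connected_graph e) (e_P5 : P5_free e)
    (e_alpha : 3 <= independence_number e) :
  exists a b c : T,
    induced_path3 e a b c /\ (forall v : T, e c v -> e v a || e v b).
Proof.
have P5 := P5_free_no_induced_path5 e_sym e_irr e_P5.
have conn : cut_connected e setT.
  move=> P x y _ _ Px nPy.
  case: (boolP [exists a, [exists b, [&& P a, ~~ P b & e a b]]]) => [|no].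
    by case/existsP=> a /existsP[b /and3P[? ? ?]]; exists a, b; rewrite !in_setT.
  have step a b : e a b -> P a -> P b.
    move=> ab Pa; apply: contraT => nPb; case/negP: no.
    by apply/existsP; exists a; apply/existsP; exists b; rewrite Pa nPb.
  have clP : closed e P.
    by move=> a b ab; apply/idP/idP; apply: step; rewrite // e_sym.
  by case/negP: nPy; rewrite -[P y](closed_connect clP (e_conn x y)).
have triple : stable_triple e setT.
  have [S stS cardS] : {S : {set T} | stable e S & independence_number e = #|S|}.
    apply: eq_bigmax_cond; apply/card_gt0P; exists set0.
    by rewrite unfold_in; apply/forall_inP=> x; rewrite inE.
  move: e_alpha; rewrite cardS => /card_gt2P[x [y [z [[xS yS zS] [xy yz zx]]]]].
  have st u v : u \in S -> v \in S -> ~~ e u v.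
    by move=> uS vS; apply: (forall_inP (forall_inP stS u uS)).
  exists x, y, z; rewrite !in_setT; split=> //.
  by rewrite /anti xy yz eq_sym zx !st.
have [a [b [c [_ [ab bc /andP[ac nac] dom]]]]] :=
  dominating_end_exists (leqnn #|T|) e_sym e_irr P5 conn triple.
exists a, b, c; split=> [|v]; last exact: dom (in_setT v).
have neq x y : e x y -> x != y by apply: contraTneq => ->; rewrite e_irr.
by rewrite /induced_path3 /= !inE negb_or ac !neq // ab bc nac.
Qed.
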